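(* Let $\sigma>0$ and $\eta\ge 0$. For all $\epsilon>0$ and $\delta>0$ there exists $n_0$ such that for every integer $n\ge n_0$ the following holds: if $x^{(n)}$ is a sample drawn from $X^{(n)}\sim\mathcal{N}(\mathbf{0},\sigma^2\mathbf{I}_n)$, then with probability at least $1-\delta$, for every perturbation $\xi\in\mathbb{R}^n$ with $\|\xi\|_2\le\eta$, the perturbed sample $x^{(n)}+\xi$ belongs to the typical set $A_{B_2}^{(n)}(X)$, where $$B_2=\frac{\eta^2 + 2 \eta\sqrt{n\sigma^2(1+2\epsilon)}}{2n\sigma^2}+\epsilon .$$
   Context: $X\sim\mathcal{N}(0,\sigma^2)$ is a real Gaussian random variable with density $f$, and $\log$ denotes the base-2 logarithm. The differential entropy of $X$ is $h(X)=-\int_{\mathbb{R}} f(x)\log f(x)\,dx$, which equals $\log(\sqrt{2\pi e}\,\sigma)$. For $B>0$ the typical set is $$A_B^{(n)}(X)=\Big\{(x_1,\dots,x_n)\in\mathbb{R}^n:\Big|-\frac1n\log f(x_1,\dots,x_n)-h(X)\Big|\le B\Big\},$$ where $f(x_1,\dots,x_n)=\prod_{i=1}^n f(x_i)$. $\mathcal{N}(\mathbf{0},\sigma^2\mathbf{I}_n)$ is the centered Gaussian distribution on $\mathbb{R}^n$ with covariance $\sigma^2$ times the identity; $\|\cdot\|_2$ is the Euclidean norm. *)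

(* Defs.v *)
From HB Require Import structures.
From mathcomp Require Import all_boot all_order all_algebra.
From mathcomp Require Import all_classical all_reals all_analysis.

Set Implicit Arguments.
Unset Strict Implicit.
Unset Printing Implicit Defensive.

Import Order.TTheory GRing.Theory Num.Theory.
Import numFieldNormedType.Exports.

Local Open Scope classical_set_scope.
Local Open Scope ring_scope.

(* R^n, with the product sigma-algebra of tuples. measurableTypeR R is R with
   the Borel sigma-algebra that carries lebesgue_measure; its display differs
   from that of the measurable structure on R itself. *)
Notation "''Rn[' R ]_ n" := (n.-tuple (measurableTypeR R))
  (at level 0, n at level 2, format "''Rn[' R ]_ n") : type_scope.

Definition cons_tuple (T : Type) (n : nat) (p : T * n.-tuple T) :
    n.+1.-tuple T := [tuple of p.1 :: p.2].

Lemma measurable_cons_tuple d (T : measurableType d) n :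
  measurable_fun [set: T * n.-tuple T] (@cons_tuple T n).
Proof. exact: measurable_cons. Qed.

Section cons_measure.
Context d (T : measurableType d) (R : realType) (n : nat).
Variable m1 : {sigma_finite_measure set T -> \bar R}.
Variable m2 : {sigma_finite_measure set (n.-tuple T) -> \bar R}.
Local Open Scope ereal_scope.

(* The product measure m1 \x m2, transported from T * T^n to T^(n+1). *)
Definition cons_measure : set (n.+1.-tuple T) -> \bar R :=
  pushforward (m1 \x m2) (@cons_tuple T n).

Let mcons := @measurable_cons_tuple d T n.

Let mpre (A : set (n.+1.-tuple T)) :
  measurable A -> measurable (@cons_tuple T n @^-1` A).
Proof. by move=> mA; rewrite -[X in measurable X]setTI; exact: mcons. Qed.

Let cons_measure0 : cons_measure set0 = 0.
Proof. by rewrite /cons_measure /pushforward preimage_set0 measure0. Qed.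

Let cons_measure_ge0 A : 0 <= cons_measure A.
Proof. exact: measure_ge0. Qed.

Let cons_measure_sigma_additive : semi_sigma_additive cons_measure.
Proof.
move=> F mF tF mUF; rewrite /cons_measure /pushforward preimage_bigcup.
apply: measure_semi_sigma_additive.
- by move=> k; exact: mpre.
- apply/trivIsetP => /= i j _ _ ij; rewrite -preimage_setI.
  by move/trivIsetP : tF => /(_ _ _ _ _ ij) ->//; rewrite preimage_set0.
- by rewrite -preimage_bigcup; exact: mpre.
Qed.

HB.instance Definition _ := isMeasure.Build _ _ _ cons_measure
  cons_measure0 cons_measure_ge0 cons_measure_sigma_additive.

Let uncons (x : n.+1.-tuple T) : T * n.-tuple T := (thead x, [tuple of behead x]).

Let unconsK : cancel uncons (@cons_tuple T n).
Proof. by move=> x; rewrite /cons_tuple/= -tuple_eta. Qed.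

Let consK : cancel (@cons_tuple T n) uncons.
Proof. by move=> [x y]; congr pair; exact: val_inj. Qed.

Let measurable_uncons : measurable_fun setT uncons.
Proof.
apply: measurable_fun_pair; [exact: measurable_tnth|exact: measurable_behead].
Qed.

Let cons_measure_sigma_finite : sigma_finite setT cons_measure.
Proof.
have /sigma_finiteP[F [TF ndF Foo]] := sigma_finiteT m1.
have /sigma_finiteP[G [TG ndG Goo]] := sigma_finiteT m2.
exists (fun k => uncons @^-1` (F k `*` G k)).
  rewrite -preimage_bigcup (_ : \bigcup_k _ = setT) ?preimage_setT//.
  apply/seteqP; split => // -[x y] _.
  have [i _ Fix] : (\bigcup_k F k) x by rewrite -TF.
  have [j _ Gjy] : (\bigcup_k G k) y by rewrite -TG.
  exists (maxn i j) => //; split => /=.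
  - by move: x Fix; exact/subsetPset/ndF/leq_maxl.
  - by move: y Gjy; exact/subsetPset/ndG/leq_maxr.
move=> k; have [mF Fk] := Foo k; have [mG Gk] := Goo k; split.
  rewrite -[X in measurable X]setTI; apply: measurable_uncons => //.
  exact: measurableX.
rewrite /cons_measure /pushforward -comp_preimage.
rewrite (_ : uncons \o _ = id); last by apply/funext => p; exact: consK.
by rewrite preimage_id product_measure1E// lte_mul_pinfty// ge0_fin_numE.
Qed.

HB.instance Definition _ := Measure_isSigmaFinite.Build _ _ _ cons_measure
  cons_measure_sigma_finite.

Lemma cons_measureE (A1 : set T) (A2 : set (n.-tuple T)) :
  measurable A1 -> measurable A2 ->
  cons_measure (@cons_tuple T n @` (A1 `*` A2)) = m1 A1 * m2 A2.
Proof.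
move=> mA1 mA2; rewrite -product_measure1E// /cons_measure /pushforward.
congr (_ _); apply/seteqP; split => [p [q qA] /(can_inj consK) <- //|p pA].
by exists p.
Qed.

End cons_measure.

Section euclidean.
Context (R : realType).

(* The n-fold product of Lebesgue measure; lebesgue_tupleE gives its values
   on boxes, which determine it. *)
Fixpoint lebesgue_tuple (n : nat) :
    {sigma_finite_measure set 'Rn[R]_n -> \bar R} :=
  if n is n'.+1 then cons_measure (@lebesgue_measure R) (lebesgue_tuple n')
  else @dirac _ 'Rn[R]_0 [tuple] R.

Lemma lebesgue_tupleE (n : nat) (A : 'I_n -> set (measurableTypeR R)) :
  (forall i, measurable (A i)) ->
  lebesgue_tuple n [set x | forall i, A i (tnth x i)] =
  (\prod_(i < n) lebesgue_measure (A i))%E.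
Proof.
elim: n A => [|n IH] A mA.
  rewrite big_ord0 /= diracE mem_set//=; by case.
rewrite big_ord_recl -IH//= -cons_measureE//; last first.
  rewrite (_ : mkset _ = \bigcap_(i in [set: 'I_n])
      ((fun x : 'Rn[R]_n => tnth x i) @^-1` A (lift ord0 i))).
    apply: fin_bigcap_measurable => // i _.
    by rewrite -[X in measurable X]setTI; exact: measurable_tnth.
  by apply/seteqP; split => [x h i _|x h i]; [exact: h|exact: (h i I)].
congr (_ _); apply/seteqP; split => [x /= xA|_ [[a x] [/= aA xA] <-] i].
  exists (thead x, [tuple of behead x]); last by rewrite /cons_tuple/= -tuple_eta.
  split=> /= [|i]; first exact: xA.
  by have := xA (lift ord0 i); rewrite [x in tnth x _](tuple_eta x) tnthS.
by case: (unliftP ord0 i) => [j ->|->]; rewrite ?tnthS.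
Qed.

Definition tuple_add (n : nat) (x y : 'Rn[R]_n) : 'Rn[R]_n :=
  [tuple tnth x i + tnth y i | i < n].

Definition norm2 (n : nat) (x : 'Rn[R]_n) : R :=
  Num.sqrt (\sum_(i < n) tnth x i ^+ 2).

Definition row_of_tuple (n : nat) (x : 'Rn[R]_n) : 'rV[R]_n :=
  \row_i tnth x i.

(* Density of N(m, S) with respect to Lebesgue measure; meaningful for S
   symmetric positive definite. *)
Definition multinormal_pdf (n : nat) (m : 'rV[R]_n) (S : 'M[R]_n)
    (x : 'Rn[R]_n) : R :=
  let y := row_of_tuple x - m in
  expR (- (y *m invmx S *m y^T) ord0 ord0 / 2) /
    Num.sqrt ((2 * pi) ^+ n * \det S).

Definition multinormal d (T : measurableType d) (P : probability T R) (n : nat)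
    (X : {RV P >-> 'Rn[R]_n}) (m : 'rV[R]_n) (S : 'M[R]_n) : Prop :=
  forall A : set 'Rn[R]_n, measurable A ->
    distribution P X A =
    (\int[lebesgue_tuple n]_(x in A) (multinormal_pdf m S x)%:E)%E.

Definition log2 (x : R) : R := ln x / ln 2.

(* Entropy and typical set depend on the random variable through its
   density f only. *)
Definition diff_entropy (f : R -> R) : R :=
  - (\int[@lebesgue_measure R]_x (f x * log2 (f x)))%R.

Definition joint_pdf (f : R -> R) (n : nat) (x : 'Rn[R]_n) : R :=
  \prod_(i < n) f (tnth x i).

Definition typical_set (f : R -> R) (n : nat) (B : R) : set 'Rn[R]_n :=
  [set x | `| - (n%:R^-1 * log2 (joint_pdf f x)) - diff_entropy f | <= B].

End euclidean.

(* Main.v *)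
(* Membership of [x] in the typical set depends on [norm2 x] only: it says that
   [norm2 x ^+ 2] is within [2 n sigma^2 (ln 2) B] of [n sigma^2].  A perturbation
   of size at most [eta] changes [norm2 x] to any nonnegative value within [eta]
   of it and to no other, which makes the event [E], a priori an uncountable
   intersection, a condition on [norm2 (X w)].  Since [eta] is fixed, the
   perturbation costs only O(sqrt n), and the term [eps] of [B2] alone leaves room
   [2 n sigma^2 a] with [a = eps ln 2]: it suffices that [norm2 (X w) ^+ 2] is
   within [n sigma^2 a] of its mean, and this is Chernoff's bound for both tails. *)
Require Import Defs.
From HB Require Import structures.
From mathcomp Require Import all_boot all_order all_algebra.
From mathcomp Require Import all_classical all_reals all_analysis.
From mathcomp Require Import measurable_realfun ring lra.

Set Implicit Arguments.
Unset Strict Implicit.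
Unset Printing Implicit Defensive.

Import Order.TTheory GRing.Theory Num.Theory.
Import numFieldNormedType.Exports.

Local Open Scope classical_set_scope.
Local Open Scope ring_scope.

(** * The centered Gaussian on the line: tilting, second moment, differential entropy *)

Section gaussian_density.
Context (R : realType).
Implicit Types s r x : R.

Lemma integrable_realZl d (T : measurableType d) (mu : {measure set T -> \bar R})
    (k : R) (f : T -> R) :
  mu.-integrable setT (EFin \o f) -> mu.-integrable setT (EFin \o (fun y => k * f y)).
Proof. by move=> /(integrableZl measurableT k); apply: eq_integrable. Qed.

Lemma normal_pdf0E s x : 0 < s ->
  normal_pdf 0 s x = normal_peak s * expR (- (x ^+ 2 / (2 * s ^+ 2))).
Proof.
move=> s0; rewrite normal_pdfE ?gt_eqF//; congr (_ * expR _).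
by rewrite subr0 mulNr mulr_natl.
Qed.

(* The exponential tilting of a centered Gaussian is a centered Gaussian, so
   [integral_normal_pdf] at another variance computes moment generating functions. *)
Lemma normal_pdf_tilt s r x : 0 < s -> 0 < r ->
  normal_pdf 0 s x * expR ((1 - r ^- 2) * x ^+ 2 / (2 * s ^+ 2)) =
  r * normal_pdf 0 (r * s) x.
Proof.
move=> s0 r0; have rs0 : 0 < r * s by exact: mulr_gt0.
rewrite !normal_pdf0E// -[LHS]mulrA -expRD [RHS]mulrA; congr (_ * expR _).
  rewrite /normal_peak (_ : (r * s) ^+ 2 * pi *+ 2 = r ^+ 2 * (s ^+ 2 * pi *+ 2)); last by ring.
  by rewrite sqrtrM ?sqr_ge0// sqrtr_sqr gtr0_norm// invfM mulVKf// gt_eqF.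
by field; rewrite !gt_eqF.
Qed.

Lemma normal_pdf_gt0 s x : 0 < s -> 0 < normal_pdf 0 s x.
Proof.
by move=> s0; rewrite normal_pdf0E// mulr_gt0 ?expR_gt0// normal_peak_gt0// gt_eqF.
Qed.

Lemma ln_normal_pdf s x : 0 < s ->
  ln (normal_pdf 0 s x) = ln (normal_peak s) - x ^+ 2 / (2 * s ^+ 2).
Proof.
move=> s0; rewrite normal_pdf0E// lnM ?posrE ?expR_gt0 ?normal_peak_gt0 ?gt_eqF//.
by rewrite expRK.
Qed.

(** Domination by a multiple of the Gaussian density of doubled deviation: tilting at [r = 2]
    produces the factor [expR (3/4 y)] with [y = x^2 / (2 s^2)], and
    [y / 2 <= 1 + 3/4 y <= expR (3/4 y)]. *)
Lemma integrable_normal_pdf_sqr s : 0 < s ->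
  (@lebesgue_measure R).-integrable [set: R]
    (EFin \o (fun x => normal_pdf 0 s x * x ^+ 2)).
Proof.
move=> s0; pose k := 2 * 2 * (2 * s ^+ 2) : R.
have := integrableZl measurableT k (integrable_normal_pdf 0 (2 * s)).
apply: le_integrable => //.
- apply/measurable_EFinP/measurable_funM; first exact: measurable_normal_pdf.
  exact: measurable_funX.
- move=> x _; rewrite -EFinM/= lee_fin.
  rewrite ger0_norm; last exact: mulr_ge0 (normal_pdf_ge0 _ _ _) (sqr_ge0 _).
  apply: le_trans (ler_norm _).
  rewrite /k [leRHS](_ : _ = (2 * (2 * s ^+ 2)) * (2 * normal_pdf 0 (2 * s) x)); last by ring.
  rewrite -normal_pdf_tilt// [leRHS]mulrCA ler_wpM2l ?normal_pdf_ge0//.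
  rewrite mulrC -ler_pdivrMr; last by rewrite !mulr_gt0// exprn_gt0.
  apply: le_trans (expR_ge1Dx _).
  have : 0 <= x ^+ 2 / (2 * s ^+ 2) by rewrite mulr_ge0 ?sqr_ge0// invr_ge0 mulr_ge0 ?sqr_ge0.
  rewrite [_ / (2 * (2 * _))](_ : _ = 2^-1 * (x ^+ 2 / (2 * s ^+ 2))); last by field; rewrite gt_eqF.
  by rewrite -[X in _ <= 1 + X]mulrA; move: (_ / _) => y y0; lra.
Qed.

Lemma Rintegral_normal_pdf s : (\int[@lebesgue_measure R]_x normal_pdf 0 s x)%R = 1.
Proof. by rewrite /Rintegral integral_normal_pdf. Qed.

(** Instead of an integration by parts: [r - 1 - (1 - r^-2) m] is nonnegative for all [r > 0] and
    vanishes at [r = 1], so its derivative [1 - 2 m] there is zero. Dividing [Hpoly] by [r - 1] on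
    either side of 1 carries this out without derivatives. *)
Lemma normal_second_moment s : 0 < s ->
  (\int[@lebesgue_measure R]_x (normal_pdf 0 s x * x ^+ 2))%R = s ^+ 2.
Proof.
move=> s0; set M := Rintegral _ _ _; pose m := M / (2 * s ^+ 2).
have ipdf t : (@lebesgue_measure R).-integrable setT (EFin \o normal_pdf 0 t).
  exact: integrable_normal_pdf.
have isqr := integrable_normal_pdf_sqr s0.
(* [1 + y <= expR y] at [y = (1 - r^-2) x^2 / (2 s^2)], integrated *)
have Hm r : 0 < r -> 1 + (1 - r ^- 2) * m <= r.
  move=> r0; have rs0 : 0 < r * s by exact: mulr_gt0.
  set c := (1 - r ^- 2) / (2 * s ^+ 2).
  have -> : 1 + (1 - r ^- 2) * m =
      (\int[@lebesgue_measure R]_x (normal_pdf 0 s x + c * (normal_pdf 0 s x * x ^+ 2)))%R.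
    rewrite RintegralD//; last exact: integrable_realZl.
    by rewrite RintegralZl// Rintegral_normal_pdf -/M /m /c mulrAC mulrA.
  rewrite -[leRHS]mulr1 -(Rintegral_normal_pdf (r * s)) -RintegralZl//.
  apply: le_Rintegral => //.
  - by apply: eq_integrable (integrableD measurableT (ipdf s) (integrable_realZl c isqr)) => //.
  - exact: integrable_realZl.
  move=> x _; rewrite -normal_pdf_tilt//.
  rewrite (_ : _ + _ = normal_pdf 0 s x * (1 + (1 - r ^- 2) * x ^+ 2 / (2 * s ^+ 2))).
    by rewrite ler_wpM2l ?normal_pdf_ge0// expR_ge1Dx.
  by rewrite /c; ring.
have Hpoly r : 0 < r -> (r - 1) * ((r + 1) * m - r ^+ 2) <= 0.
  move=> r0; have := Hm _ r0; rewrite -(ler_pM2l (exprn_gt0 2 r0)).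
  rewrite (_ : _ * (1 + _) = r ^+ 2 + (r ^+ 2 - 1) * m); last by field; rewrite gt_eqF.
  by move=> h; nra.
suff : m = 2^-1.
  by rewrite /m => /(canRL (divfK _)) ->; rewrite ?mulKf// mulf_neq0// expf_neq0// gt_eqF.
have m0 : 0 <= m.
  apply: mulr_ge0; last by rewrite invr_ge0 mulr_ge0 ?sqr_ge0.
  by apply: Rintegral_ge0 => x _; exact: mulr_ge0 (normal_pdf_ge0 _ _ _) (sqr_ge0 _).
apply/eqP; rewrite eq_le; apply/andP; split.
- apply/ler_addgt0Pr => e e0; have r0 : 0 < 1 + e by lra.
  have := Hpoly _ r0; rewrite (_ : _ * _ = e * ((2 + e) * m - (1 + e) ^+ 2)); last by ring.
  by rewrite pmulr_rle0// => h; nra.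
(* [Hpoly] is applied at [1 - e], which is positive only for [e < 1]; for larger [e], [m0]
   suffices. *)
- apply/ler_addgt0Pr => e e0; have [e1|e1] := ltP e 1; last by lra.
  have r0 : 0 < 1 - e by lra.
  have := Hpoly _ r0; rewrite (_ : _ * _ = e * ((1 - e) ^+ 2 - (2 - e) * m)); last by ring.
  by rewrite pmulr_rle0// => h; nra.
Qed.

(** The log-density is affine in [x^2], so only the total mass and the second moment enter. Since
    [normal_peak s] is [1 / (s sqrt(2 pi))], the value is the familiar [log2 (s sqrt(2 pi e))]. *)
Lemma diff_entropy_normal s : 0 < s ->
  diff_entropy (normal_pdf 0 s) = (2^-1 - ln (normal_peak s)) / ln 2.
Proof.
move=> s0; rewrite /diff_entropy.
pose c := (ln 2)^-1 / (2 * s ^+ 2).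
under eq_Rintegral => x _.
  rewrite /log2 ln_normal_pdf// (_ : _ * _ = ln (normal_peak s) / ln 2 * normal_pdf 0 s x
     + - c * (normal_pdf 0 s x * x ^+ 2)); last by rewrite /c; ring.
  over.
have isqr := integrable_normal_pdf_sqr s0.
rewrite RintegralD//; last 2 first.
- by apply: integrable_realZl => //; exact: integrable_normal_pdf.
- exact: integrable_realZl.
rewrite !RintegralZl//; last exact: integrable_normal_pdf.
rewrite Rintegral_normal_pdf normal_second_moment// /c.
by field; rewrite ?gt_eqF// ln_gt0// ltr1n.
Qed.

End gaussian_density.

(** * Product densities on ['Rn[R]_n] and their integrals *)

Section product_densities.
Context (R : realType).

Lemma measurable_tuple_prod n (g : R -> R) : measurable_fun setT g ->
  measurable_fun setT (fun x : 'Rn[R]_n => \prod_(i < n) g (tnth x i)).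
Proof.
move=> mg; apply: measurable_prod => i _.
exact: (measurableT_comp mg (measurable_tnth i)).
Qed.

Lemma integral_lebesgue_tuple_prod n (g : R -> R) :
  measurable_fun setT g -> (forall x, 0 <= g x) ->
  (\int[lebesgue_tuple R n]_x (\prod_(i < n) g (tnth x i))%:E =
   (\int[@lebesgue_measure R]_x (g x)%:E) ^+ n)%E.
Proof.
move=> mg g0.
have mF k : measurable_fun setT (fun x : 'Rn[R]_k => (\prod_(i < k) g (tnth x i))%:E).
  by apply/measurable_EFinP; exact: measurable_tuple_prod.
elim: n => [|n IH].
  rewrite [lebesgue_tuple R 0]/= integral_dirac//; last exact: (mF 0%N).
  by rewrite big_ord0 diracT mul1e.
(* Unfolding [cons_measure] to a pushforward allows a change of variables to the binary product,
   where Tonelli splits off the first coordinate. *)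
transitivity (\int[pushforward (@lebesgue_measure R \x lebesgue_tuple R n)
    (@Defs.cons_tuple (measurableTypeR R) n)]_x (\prod_(i < n.+1) g (tnth x i))%:E)%E => //.
rewrite (ge0_integral_pushforward (@Defs.measurable_cons_tuple _ (measurableTypeR R) n))//; last 2 first.
- exact: (mF n.+1).
- by move=> x _; rewrite lee_fin prodr_ge0.
rewrite preimage_setT fubini_tonelli1; last 2 first.
- exact: measurableT_comp (mF _) (@Defs.measurable_cons_tuple _ (measurableTypeR R) n).
- by move=> x; rewrite lee_fin prodr_ge0.
rewrite expeS -IH -ge0_integralZr//; last 3 first.
- exact/measurable_EFinP.
- by move=> x _; rewrite lee_fin.
- by apply: integral_ge0 => x _; rewrite lee_fin prodr_ge0.
apply: eq_integral => x _; rewrite /fubini_F/=.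
rewrite -ge0_integralZl//; last 3 first.
- exact: mF.
- by move=> y _; rewrite lee_fin prodr_ge0.
- by rewrite lee_fin.
apply: eq_integral => y _; rewrite -EFinM big_ord_recl; congr (_ * _)%:E.
by apply: eq_bigr => i _; rewrite tnthS.
Qed.

Lemma norm2_ge0 n (x : 'Rn[R]_n) : 0 <= norm2 x.
Proof. exact: sqrtr_ge0. Qed.

Lemma sqr_norm2 n (x : 'Rn[R]_n) : norm2 x ^+ 2 = \sum_(i < n) tnth x i ^+ 2.
Proof. by rewrite sqr_sqrtr// sumr_ge0// => i _; exact: sqr_ge0. Qed.

Lemma measurable_norm2 n : measurable_fun setT (@norm2 R n).
Proof.
rewrite (_ : @norm2 R n = Num.sqrt \o (fun x : 'Rn[R]_n => \sum_(i < n) tnth x i ^+ 2))//.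
apply: measurableT_comp; first exact: continuous_measurable_fun (@sqrt_continuous R).
apply: measurable_sum => i; apply: measurable_funX; exact: measurable_tnth.
Qed.

Lemma ln_joint_normal_pdf n s (x : 'Rn[R]_n) : 0 < s ->
  ln (joint_pdf (normal_pdf 0 s) x) =
  n%:R * ln (normal_peak s) - norm2 x ^+ 2 / (2 * s ^+ 2).
Proof.
move=> s0; rewrite /joint_pdf.
have -> : \prod_(i < n) normal_pdf 0 s (tnth x i) =
    expR (\sum_(i < n) ln (normal_pdf 0 s (tnth x i))).
  by rewrite expR_sum; apply: eq_bigr => i _; rewrite lnK// posrE normal_pdf_gt0.
rewrite expRK; under eq_bigr do rewrite ln_normal_pdf//.
by rewrite big_split/= sumr_const card_ord -[_ *+ n]mulr_natl sumrN -mulr_suml sqr_norm2.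
Qed.

(** The bridge from the matrix form of the law of [X] to independent coordinates: a scalar
    covariance has an explicit inverse and determinant. *)
Lemma multinormal_pdf_scalar n (s : R) (x : 'Rn[R]_n) : 0 < s ->
  multinormal_pdf 0 (s ^+ 2)%:M x = joint_pdf (normal_pdf 0 s) x.
Proof.
move=> s0; rewrite /multinormal_pdf /joint_pdf subr0.
under eq_bigr do rewrite normal_pdf0E//.
rewrite big_split/= prodr_const card_ord -expR_sum sumrN -mulr_suml -sqr_norm2.
rewrite mulrC invmx_scalar mul_mx_scalar -scalemxAl mxE det_scalar -exprMn; congr (_ * expR _).
  rewrite /normal_peak exprVn; congr (_^-1).
  rewrite (_ : 2 * pi * s ^+ 2 = Num.sqrt (s ^+ 2 * pi *+ 2) ^+ 2).
    by rewrite exprAC sqrtr_sqr ger0_norm// exprn_ge0// sqrtr_ge0.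
  rewrite sqr_sqrtr; first by ring.
  by rewrite pmulrn_lge0// mulr_ge0 ?sqr_ge0 ?pi_ge0.
rewrite mxE (_ : \sum_j _ = norm2 x ^+ 2).
  by field; rewrite gt_eqF.
by rewrite sqr_norm2; apply: eq_bigr => i _; rewrite !mxE.
Qed.

End product_densities.

(** * Chernoff bounds for the squared norm of a Gaussian vector *)

Section concentration.
Context (R : realType).

(* [r > 1] bounds the upper tail, [r < 1] the lower one. *)
Lemma gaussian_tail n (s r b : R) (A : set 'Rn[R]_n) :
  0 < s -> 0 < r -> measurable A ->
  (forall x, A x -> (1 - r ^- 2) * (n%:R * s ^+ 2 * b) <= (1 - r ^- 2) * norm2 x ^+ 2) ->
  (\int[lebesgue_tuple R n]_(x in A) (multinormal_pdf 0 (s ^+ 2)%:M x)%:E <=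
   ((r * expR (- ((1 - r ^- 2) * b / 2))) ^+ n)%:E)%E.
Proof.
move=> s0 r0 mA hA; have rs0 : 0 < r * s by exact: mulr_gt0.
pose c := expR (- ((1 - r ^- 2) * b / 2)).
(* By tilting, the product of the [g (tnth x i)] is the Gaussian density times an exponential weight
   that [hA] makes at least 1 on [A]. Over the whole space it integrates to [(r * c) ^+ n], the
   tilted density having mass 1. *)
pose g x := c * (r * normal_pdf 0 (r * s) x).
have c0 : 0 <= c by exact: expR_ge0.
have g0 x : 0 <= g x by rewrite !mulr_ge0 ?normal_pdf_ge0// ltW.
have mg : measurable_fun setT g.
  by apply: measurable_funM => //; apply: measurable_funM => //; exact: measurable_normal_pdf.
have mF (h : R -> R) : measurable_fun setT h -> measurable_fun setT
    (fun x : 'Rn[R]_n => (\prod_(i < n) h (tnth x i))%:E).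
  by move=> mh; apply/measurable_EFinP; exact: measurable_tuple_prod.
under eq_integral do rewrite multinormal_pdf_scalar//.
apply: (@le_trans _ _ (\int[lebesgue_tuple R n]_(x in A) (\prod_(i < n) g (tnth x i))%:E)%E).
  apply: ge0_le_integral => //.
  - by move=> x _; rewrite lee_fin prodr_ge0// => i _; rewrite normal_pdf_ge0.
  - exact: measurable_funTS (mF _ (measurable_normal_pdf 0 s)).
  - exact: measurable_funTS (mF _ mg).
  move=> x Ax; rewrite lee_fin /joint_pdf.
  rewrite (_ : \prod_(i < n) g _ = (\prod_(i < n) normal_pdf 0 s (tnth x i)) *
    expR (((1 - r ^- 2) * norm2 x ^+ 2 - (1 - r ^- 2) * (n%:R * s ^+ 2 * b)) / (2 * s ^+ 2))).
    rewrite ler_peMr//; first by rewrite prodr_ge0// => i _; exact: normal_pdf_ge0.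
    by rewrite -[leLHS]expR0 ler_expR divr_ge0 ?subr_ge0 ?hA// mulr_ge0 ?sqr_ge0.
  rewrite sqr_norm2.
  rewrite [X in expR X](_ : _ = \sum_(i < n) ((1 - r ^- 2) * tnth x i ^+ 2 / (2 * s ^+ 2)
     - (1 - r ^- 2) * b / 2)).
    rewrite expR_sum -big_split/=; apply: eq_bigr => i _.
    by rewrite expRD mulrA normal_pdf_tilt// mulrC.
  rewrite big_split/= sumr_const card_ord -mulr_suml -mulr_sumr -[_ *+ n]mulr_natl.
  by field; rewrite !gt_eqF.
apply: le_trans (_ : _ <= \int[lebesgue_tuple R n]_x (\prod_(i < n) g (tnth x i))%:E)%E _.
  apply: ge0_subset_integral => //; first exact: mF.
  by move=> x _; rewrite lee_fin prodr_ge0.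
rewrite integral_lebesgue_tuple_prod//.
suff -> : (\int[@lebesgue_measure R]_x (g x)%:E = (r * c)%:E)%E by rewrite EFin_expe.
under eq_integral do rewrite /g mulrA EFinM.
rewrite ge0_integralZl//.
- by rewrite integral_normal_pdf mule1 mulrC.
- by apply/measurable_EFinP; exact: measurable_normal_pdf.
- by move=> x _; rewrite lee_fin normal_pdf_ge0.
- by rewrite lee_fin mulr_ge0// ltW.
Qed.

(** By [1 + y <= expR y] it suffices that [r < 1 + (1 - r^-2) b / 2]; the hypothesis is this
    inequality with denominators cleared. *)
Lemma tail_base_lt1 (r b : R) : 0 < r -> 0 < (r - 1) * ((r + 1) * b - 2 * r ^+ 2) ->
  r * expR (- ((1 - r ^- 2) * b / 2)) < 1.
Proof.
move=> r0 h; rewrite expRN ltr_pdivrMr ?expR_gt0// mul1r.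
apply: lt_le_trans (expR_ge1Dx _); rewrite -subr_gt0.
rewrite (_ : _ - r = (r - 1) * ((r + 1) * b - 2 * r ^+ 2) / (2 * r ^+ 2)).
  by rewrite divr_gt0// mulr_gt0// exprn_gt0.
by field; rewrite gt_eqF.
Qed.

(** At [r = 1] the second factor in [tail_base_lt1] is [2 b - 2], which is [2 a] for the upper tail
    and [- 2 a] for the lower one, so a small move of [r] up, respectively down, makes the product
    positive. *)
Lemma chernoff_bases (a : R) : 0 < a ->
  exists r1 r2 : R, [/\ 1 < r1, r1 * expR (- ((1 - r1 ^- 2) * (1 + a) / 2)) < 1,
    0 < r2 < 1 & r2 * expR (- ((1 - r2 ^- 2) * (1 - a) / 2)) < 1].
Proof.
(* With [h (3 + a) = a], the second factors at [1 + h] and [1 - h] become [a + 2 a h - 2 h^2] and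
   [- (a + 2 h^2)]. *)
move=> a0; pose h := a / (3 + a).
have h0 : 0 < h by rewrite divr_gt0//; lra.
have h1 : h < 1 by rewrite ltr_pdivrMr; lra.
have hE : h * (3 + a) = a by rewrite divfK// gt_eqF//; lra.
exists (1 + h), (1 - h); split; [lra| |by apply/andP; split; lra|].
- apply: tail_base_lt1; first lra.
  rewrite [X in X * _](_ : _ = h); last by ring.
  by apply: mulr_gt0 => //; nra.
- apply: tail_base_lt1; first lra.
  rewrite (_ : _ * _ = h * (2 * (1 - h) ^+ 2 - (2 - h) * (1 - a))); last by ring.
  by apply: mulr_gt0 => //; nra.
Qed.

(** The Chernoff bases depend on [a] only, so both tails decay geometrically in [n] and one [n0]
    serves every probability space and every [X]. Each tail receives [delta / 2]. *)
Lemma gaussian_concentration (s a delta : R) : 0 < s -> 0 < a -> 0 < delta ->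
  exists n0 : nat, forall n : nat, (n0 <= n)%N ->
  forall d (T : measurableType d) (P : probability T R) (X : {RV P >-> 'Rn[R]_n}),
  multinormal X 0 (s ^+ 2)%:M ->
  let G := [set w | `|norm2 (X w) ^+ 2 - n%:R * s ^+ 2| <= n%:R * s ^+ 2 * a] in
  measurable G /\ ((1 - delta)%:E <= P G)%E.
Proof.
move=> s0 a0 delta0; have [r1 [r2 [r1_gt1 q1 /andP[r20 r21] q2]]] := chernoff_bases a0.
set q1' := (X in X < 1) in q1; set q2' := (X in X < 1) in q2.
have q10 : 0 <= q1' by rewrite mulr_ge0 ?expR_ge0//; lra.
have q20 : 0 <= q2' by rewrite mulr_ge0 ?expR_ge0//; lra.
have small (q : R) : 0 <= q -> q < 1 -> \forall n \near \oo, q ^+ n <= delta / 2.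
  move=> q_ge0 q_lt1; have q_norm : `|q| < 1 by rewrite ger0_norm.
  have /cvgrPdist_le := cvg_expr q_norm; have d20 : 0 < delta / 2 by rewrite divr_gt0.
  move=> /(_ _ d20); apply: filterS => n.
  by rewrite sub0r normrN ger0_norm// exprn_ge0.
have [n0 _ Hn0] := filterI (small _ q10 q1) (small _ q20 q2).
exists n0 => n /Hn0[hq1 hq2] d T P X XN G.
pose A1 := [set x : 'Rn[R]_n | n%:R * s ^+ 2 * (1 + a) <= norm2 x ^+ 2].
pose A2 := [set x : 'Rn[R]_n | norm2 x ^+ 2 <= n%:R * s ^+ 2 * (1 - a)].
have mN2 : measurable_fun setT (fun x : 'Rn[R]_n => norm2 x ^+ 2).
  by apply: measurable_funX; exact: measurable_norm2.
have mA1 : measurable A1.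
  by rewrite -[A1]setTI; exact: measurable_fun_le.
have mA2 : measurable A2 by rewrite -[A2]setTI; exact: measurable_fun_le.
have PA1 : (P (X @^-1` A1) <= (delta / 2)%:E)%E.
  have -> : P (X @^-1` A1) = distribution P X A1 by [].
  rewrite XN//; apply: le_trans (gaussian_tail (r := r1) (b := 1 + a) s0 _ mA1 _) _.
  - lra.
  - move=> x Ax; rewrite ler_wpM2l// subr_ge0 invf_le1; last by rewrite exprn_gt0; lra.
    by rewrite exprn_ege1//; lra.
  - by rewrite lee_fin.
have PA2 : (P (X @^-1` A2) <= (delta / 2)%:E)%E.
  have -> : P (X @^-1` A2) = distribution P X A2 by [].
  rewrite XN//; apply: le_trans (gaussian_tail (r := r2) (b := 1 - a) s0 _ mA2 _) _.
  - lra.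
  - move=> x Ax; rewrite ler_wnM2l// subr_le0 invf_ge1; last by rewrite exprn_gt0; lra.
    by rewrite exprn_ile1//; lra.
  - by rewrite lee_fin.
have mG : measurable G.
  rewrite -[G]setTI; apply: measurable_fun_le => //.
  have mX : measurable_fun setT (fun w => norm2 (X w) ^+ 2).
    exact: measurableT_comp mN2 (measurable_funPT X).
  by apply: (measurableT_comp (@normr_measurable R setT)); exact: measurable_funB.
split => //.
have mX (A : set 'Rn[R]_n) : measurable A -> measurable (X @^-1` A) by exact: measurable_funPTI.
have sub : ~` (X @^-1` A1 `|` X @^-1` A2) `<=` G.
  move=> w /not_orP[/= /negP h1 /negP h2]; rewrite /G /= ler_norml.
  by apply/andP; split; move: h1 h2; rewrite /A1 /A2 /= -!ltNge; lra.
have mU : measurable (X @^-1` A1 `|` X @^-1` A2) by apply: measurableU; exact: mX.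
apply: (@le_trans _ _ (P (~` (X @^-1` A1 `|` X @^-1` A2)))); last first.
  by apply: le_measure => //; rewrite inE//; exact: measurableC.
rewrite probability_setC// EFinB leeB//.
apply: le_trans (measureU2 _ (mX _ mA1) (mX _ mA2)) _.
by rewrite [delta]splitr EFinD leeD.
Qed.

End concentration.

(** * Typicality in terms of the norm, and the norms that perturbations reach *)

Section typicality.
Context (R : realType).

Lemma norm2_add n (x y : 'Rn[R]_n) :
  norm2 (tuple_add x y) ^+ 2 =
  norm2 x ^+ 2 + 2 * (\sum_(i < n) tnth x i * tnth y i) + norm2 y ^+ 2.
Proof.
rewrite !sqr_norm2 mulr_sumr -!big_split/=; apply: eq_bigr => i _.
by rewrite tnth_mktuple; ring.
Qed.

(** Cauchy-Schwarz: for nonzero [y], the squared norm of [|y|^2 x - p y] is nonnegative and equals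
    [|y|^2 (|x|^2 |y|^2 - p^2)]. *)
Lemma dot_le_norm2 n (x y : 'Rn[R]_n) :
  `|\sum_(i < n) tnth x i * tnth y i| <= norm2 x * norm2 y.
Proof.
set p := \sum_(i < n) _; have [y0|y_neq0] := eqVneq (norm2 y) 0.
  suff -> : p = 0 by rewrite normr0 y0 mulr0.
  have /eqP : norm2 y ^+ 2 = 0 by rewrite y0 expr0n.
  rewrite sqr_norm2 psumr_eq0 => [/allP h|i _]; last exact: sqr_ge0.
  rewrite /p big1// => i _; have := h i (mem_index_enum i).
  by rewrite /= sqrf_eq0 => /eqP ->; rewrite mulr0.
have y_gt0 : 0 < norm2 y by rewrite lt_def y_neq0 norm2_ge0.
rewrite -ler_sqr ?nnegrE ?mulr_ge0 ?norm2_ge0// real_normK ?num_real// exprMn.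
have : 0 <= \sum_(i < n) (norm2 y ^+ 2 * tnth x i - p * tnth y i) ^+ 2.
  by apply: sumr_ge0 => i _; exact: sqr_ge0.
rewrite (_ : \sum_(i < n) _ = (norm2 y ^+ 2) ^+ 2 * (\sum_(i < n) tnth x i ^+ 2)
    - 2 * norm2 y ^+ 2 * p * (\sum_(i < n) tnth x i * tnth y i)
    + p ^+ 2 * (\sum_(i < n) tnth y i ^+ 2)).
  rewrite -!sqr_norm2 -/p (_ : _ + _ = norm2 y ^+ 2 * (norm2 x ^+ 2 * norm2 y ^+ 2 - p ^+ 2)).
    by rewrite pmulr_rge0 ?exprn_gt0// subr_ge0.
  by ring.
by move: p => q; rewrite !mulr_sumr -sumrB -big_split/=; apply: eq_bigr => i _; ring.
Qed.

Lemma norm2_perturb n (x y : 'Rn[R]_n) :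
  `|norm2 (tuple_add x y) - norm2 x| <= norm2 y.
Proof.
have := dot_le_norm2 x y; rewrite ler_norml => /andP[h1 h2].
have E := norm2_add x y; move: (norm2_ge0 x) (norm2_ge0 y) (norm2_ge0 (tuple_add x y)).
move: E h1 h2; move: (\sum_(i < n) _) (norm2 x) (norm2 y) (norm2 _) => p a b c E h1 h2 a0 b0 c0.
have h3 : c <= a + b by rewrite -ler_sqr ?nnegrE ?addr_ge0// E; nra.
have h4 : (a - b) ^+ 2 <= c ^+ 2 by rewrite E; nra.
rewrite ler_norml; apply/andP; split; last by lra.
have [ab|ab] := leP a b; first by lra.
suff : a - b <= c by lra.
by rewrite -ler_sqr ?nnegrE// subr_ge0 ltW.
Qed.

(** Moving [x] along its own direction [u] by [t - norm2 x] gives [t u]. The zero vector has no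
    direction of its own, and the first basis vector takes that role. *)
Lemma norm2_reach n (x : 'Rn[R]_n) (t : R) : (0 < n)%N -> 0 <= t ->
  exists2 y : 'Rn[R]_n, norm2 y = `|t - norm2 x| & norm2 (tuple_add x y) = t.
Proof.
case: n x => // n x _ t0.
have normZ (u : 'Rn[R]_n.+1) (c : R) : norm2 [tuple c * tnth u i | i < n.+1] = `|c| * norm2 u.
  rewrite -[LHS]ger0_norm ?norm2_ge0// -[X in _ * X]ger0_norm ?norm2_ge0// -!sqrtr_sqr.
  rewrite -sqrtrM ?sqr_ge0//; congr Num.sqrt; rewrite !sqr_norm2 mulr_sumr.
  by apply: eq_bigr => i _; rewrite tnth_mktuple exprMn.
have [u u1 xu] : exists2 u : 'Rn[R]_n.+1, norm2 u = 1 & forall i, tnth x i = norm2 x * tnth u i.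
  have [x0|x0] := eqVneq (norm2 x) 0.
    exists [tuple ((i == ord0)%:R : R) | i < n.+1].
      rewrite -[LHS]ger0_norm ?norm2_ge0// -sqrtr_sqr sqr_norm2 big_ord_recl big1.
        by rewrite tnth_mktuple addr0 expr1n sqrtr1.
      by move=> i _; rewrite tnth_mktuple expr0n.
    move=> i; rewrite x0 mul0r; have /eqP : norm2 x ^+ 2 = 0 by rewrite x0 expr0n.
    rewrite sqr_norm2 psumr_eq0 => [/allP h|j _]; last exact: sqr_ge0.
    by have := h i (mem_index_enum i); rewrite /= sqrf_eq0 => /eqP.
  exists [tuple (norm2 x)^-1 * tnth x i | i < n.+1].
    by rewrite normZ normfV ger0_norm ?norm2_ge0// mulVf.
  by move=> i; rewrite tnth_mktuple mulVKf.
exists [tuple (t - norm2 x) * tnth u i | i < n.+1]; first by rewrite normZ u1 mulr1.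
rewrite (_ : tuple_add _ _ = [tuple t * tnth u i | i < n.+1]).
  by rewrite normZ u1 mulr1 ger0_norm.
by apply: eq_from_tnth => i; rewrite !tnth_mktuple xu; ring.
Qed.

(** The [normal_peak] terms of the empirical and the differential entropy cancel; the summand [1/2]
    of the latter becomes the center [n s^2]. *)
Lemma typical_set_normalE n (s B : R) (x : 'Rn[R]_n) : (0 < n)%N -> 0 < s ->
  typical_set (normal_pdf 0 s) B x <->
  `|norm2 x ^+ 2 - n%:R * s ^+ 2| <= 2 * n%:R * s ^+ 2 * ln 2 * B.
Proof.
move=> n0 s0; have n0' : 0 < n%:R :> R by rewrite ltr0n.
have l2 : 0 < ln 2 :> R by rewrite ln_gt0// ltr1n.
rewrite /typical_set /= /log2 ln_joint_normal_pdf// diff_entropy_normal//.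
rewrite (_ : _ - _ = (norm2 x ^+ 2 - n%:R * s ^+ 2) / (2 * n%:R * s ^+ 2 * ln 2)).
  have D : 0 < 2 * n%:R * s ^+ 2 * ln 2 by rewrite !mulr_gt0// exprn_gt0.
  by rewrite normrM normfV (gtr0_norm D) ler_pdivrMr// [B * _]mulrC.
by field; rewrite !gt_eqF.
Qed.

(** Squaring is monotone on nonnegative reals, so only the endpoints of the range of [t] matter.
    This trades the quantifier for two inequalities measurable in [N]. *)
Lemma forall_dist_sqr_le (N eta c K : R) : 0 <= N -> 0 <= eta ->
  (forall t, 0 <= t -> `|t - N| <= eta -> `|t ^+ 2 - c| <= K) <->
  c - K <= Num.max 0 (N - eta) ^+ 2 /\ (N + eta) ^+ 2 <= c + K.
Proof.
move=> N0 eta0; split=> [h|[h1 h2] t t0].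
  have /h : 0 <= N + eta by rewrite addr_ge0.
  rewrite addrAC subrr add0r ger0_norm// => /(_ (lexx _)); rewrite ler_norml => /andP[_ h2].
  split; last by lra.
  have m0 : 0 <= Num.max 0 (N - eta) by rewrite le_max lexx.
  have mN : `|Num.max 0 (N - eta) - N| <= eta.
    by rewrite ler_norml; have [?|?] := leP 0 (N - eta); apply/andP; split; lra.
  by have := h _ m0 mN; rewrite ler_norml => /andP[? _]; lra.
rewrite !ler_norml => /andP[t1 t2]; apply/andP; split.
  suff : Num.max 0 (N - eta) ^+ 2 <= t ^+ 2 by lra.
  rewrite ler_sqr ?nnegrE// ?le_max ?lexx// ge_max t0/=; lra.
suff : t ^+ 2 <= (N + eta) ^+ 2 by lra.
by rewrite ler_sqr ?nnegrE// ?addr_ge0//; lra.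
Qed.

End typicality.

(** * The choice of [n0] and the absorption of the perturbation *)

Theorem theorem3p8 (R : realType) (sigma eta : R)
    (sigma_gt0 : 0 < sigma) (eta_ge0 : 0 <= eta)
    (eps delta : R) (eps_gt0 : 0 < eps) (delta_gt0 : 0 < delta) :
  exists n0 : nat, forall n : nat, (n0 <= n)%N ->
  forall (d : measure_display) (T : measurableType d) (P : probability T R)
    (X : {RV P >-> 'Rn[R]_n}),
  multinormal X 0 (sigma ^+ 2)%:M ->
  let B2 := (eta ^+ 2 + 2 * eta * Num.sqrt (n%:R * sigma ^+ 2 * (1 + 2 * eps)))
              / (2 * n%:R * sigma ^+ 2) + eps in
  let E := [set w | forall xi : 'Rn[R]_n, norm2 xi <= eta ->
      typical_set (normal_pdf 0 sigma) B2 (tuple_add (X w) xi)] in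
  measurable E /\ ((1 - delta)%:E <= P E)%E.
Proof.
have l2 : 0 < ln 2 :> R by rewrite ln_gt0// ltr1n.
pose a := eps * ln 2; have a0 : 0 < a by rewrite mulr_gt0.
have [n1 conc] := gaussian_concentration sigma_gt0 a0 delta_gt0.
(* [r] is the weight in the AM-GM step below. [C] is the dimension from which the terms [eta^2] and
   [eta^2 / r] together cost at most [c * (a / 2)]. *)
pose r := a / (2 * (1 + a)); have r0 : 0 < r by rewrite divr_gt0//; lra.
pose C := eta ^+ 2 * (1 + r^-1) / (sigma ^+ 2 * (a / 2)).
have [n2 n2C] : exists n2 : nat, C <= n2%:R.
  by exists (Num.bound `|C|); apply: le_trans (ler_norm _) (ltW (archi_boundP _)).
exists (maxn 1 (maxn n1 n2)) => n; rewrite !geq_max => /and3P[n0 n1n n2n] d T P X XN B2 E.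
have n0' : 0 < n%:R :> R by rewrite ltr0n.
set c := n%:R * sigma ^+ 2; have c0 : 0 < c by rewrite mulr_gt0// exprn_gt0.
set K := 2 * n%:R * sigma ^+ 2 * ln 2 * B2.
have aK : c * a + c * a <= K.
  rewrite /K (_ : _ + _ = 2 * n%:R * sigma ^+ 2 * ln 2 * eps); last by rewrite /a /c; ring.
  have D0 : 0 <= 2 * n%:R * sigma ^+ 2 by rewrite mulr_ge0 ?sqr_ge0// mulr_ge0.
  apply: ler_wpM2l; first by rewrite mulr_ge0// ltW.
  rewrite lerDr divr_ge0// addr_ge0 ?sqr_ge0//.
  by rewrite mulr_ge0 ?sqrtr_ge0// mulr_ge0.
have large : eta ^+ 2 * (1 + r^-1) <= c * (a / 2).
  have : C <= n%:R by apply: le_trans n2C _; rewrite ler_nat.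
  rewrite /C ler_pdivrMr; first by rewrite [n%:R * _]mulrA.
  by apply: mulr_gt0; [exact: exprn_gt0|exact: divr_gt0].
(* [norm2_reach] realizes every admissible [t] by a perturbation; [norm2_perturb] gives the
   converse. *)
have EE : E = [set w | forall t, 0 <= t -> `|t - norm2 (X w)| <= eta -> `|t ^+ 2 - c| <= K].
  apply/seteqP; split => w /= Ew.
    move=> t t0 tX; have [y y1 <-] := norm2_reach (X w) n0 t0.
    by apply/(typical_set_normalE _ _ n0 sigma_gt0); apply: Ew; rewrite y1.
  move=> xi xi_le; apply/(typical_set_normalE _ _ n0 sigma_gt0); apply: Ew; first exact: norm2_ge0.
  exact: le_trans (norm2_perturb _ _) xi_le.
have mX : measurable_fun setT (fun w => norm2 (X w)).
  exact: measurableT_comp (@measurable_norm2 R n) (measurable_funPT X).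
have mE : measurable E.
  rewrite (_ : E = [set w | c - K <= Num.max 0 (norm2 (X w) - eta) ^+ 2] `&`
      [set w | (norm2 (X w) + eta) ^+ 2 <= c + K]).
    rewrite -[X in X `&` _]setTI -[X in _ `&` X]setTI.
    apply: measurableI; apply: measurable_fun_le => //; apply: measurable_funX.
      by apply: measurable_maxr => //; exact: measurable_funB.
    exact: measurable_funD.
  by rewrite EE; apply/seteqP; split => w /= /(forall_dist_sqr_le _ _ (norm2_ge0 (X w)) eta_ge0).
split => //; have [mG PG] := conc n n1n d T P X XN; apply: le_trans PG _.
apply: le_measure; rewrite ?inE//.
rewrite EE => w /= Gw t t0 tX; rewrite -/c in Gw.
move: Gw tX (norm2_ge0 (X w)); move: (norm2 (X w)) => N Gw tX N0.
(* AM-GM: [2 N eta <= r N^2 + eta^2 / r], and [r * c * (1 + a) = c * a / 2] *)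
have amgm : 2 * (N * eta) <= r * N ^+ 2 + eta ^+ 2 * r^-1.
  rewrite -subr_ge0 (_ : _ - _ = (r * N - eta) ^+ 2 / r); last by field; rewrite gt_eqF.
  by rewrite divr_ge0 ?sqr_ge0// ltW.
have rc : r * (c * (1 + a)) = c * (a / 2) by rewrite /r; field; rewrite gt_eqF//; lra.
have rN : r * N ^+ 2 <= c * (a / 2).
  by rewrite -rc ler_wpM2l ?(ltW r0)//; move: Gw; rewrite ler_norml => /andP[_ ?]; lra.
have sq : (t - N) ^+ 2 <= eta ^+ 2.
  by rewrite -[leLHS]real_normK ?num_real// ler_sqr ?nnegrE.
have cross : `|2 * (N * (t - N))| <= 2 * (N * eta).
  by rewrite !normrM normr_nat (ger0_norm N0) !ler_wpM2l.
(* The three terms are at most [eta^2], [c * (a / 2) + eta^2 / r] and [c * a]; by [large] they add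
   up to at most [2 c a], which [aK] bounds by [K]. *)
rewrite (_ : _ - c = (t - N) ^+ 2 + 2 * (N * (t - N)) + (N ^+ 2 - c)); last by ring.
apply: le_trans (ler_normD _ _) _; apply: le_trans (lerD (ler_normD _ _) Gw) _.
rewrite ger0_norm ?sqr_ge0//; lra.
Qed.
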